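(* Consider a single-input single-output linear time-invariant system $\dot x=Ax+Bu$, $y=Cx$, given by a minimal realization with $A\in\mathbb R^{n\times n}$ Hurwitz, with transfer function $H(\lambda)=C(\lambda I-A)^{-1}B$, driven by the harmonic signal generator $\dot z=S(\varpi)z$, $u=Lz$ with parameter $\omega=(\varpi,a_u,\phi_u)\in\mathbb R_+^2\times\mathbb R$ and initial condition $z_0(\omega)=(a_u\sin\phi_u,a_u\cos\phi_u)\in\mathbb R^2$. Then the associated frequency response function $\Gamma$ satisfies $$\Gamma(\omega)=H(j\varpi).$$
   Context: $\mathbb R_+$ denotes the strictly positive reals. Here $S(\varpi)=\begin{bmatrix}0&\varpi\\-\varpi&0\end{bmatrix}$, $L=\begin{bmatrix}1&0\end{bmatrix}$, so $z(t)$ is periodic with period $T_\omega=2\pi/\varpi$. Write $\ell(\omega,z)=Lz$ for the input and $\dot\ell(\omega,z)$ for its time derivative along $z(t)$. The $\omega$-response (steady-state output) is $Y(\omega,z)=C\Phi(\varpi)z$, where $\Phi(\varpi)\in\mathbb R^{n\times2}$ is the unique solution of the Sylvester equation $A\Phi(\varpi)+BL=\Phi(\varpi)S(\varpi)$. With $\langle f,g\rangle=\int_0^{T_\omega}f(t)^\top g(t)\,dt$ and $\|f\|=\sqrt{\langle f,f\rangle}$, and functions of $z$ evaluated along $z(t)$, define $$\alpha(\omega)=\frac{\|Y(\omega,z)\|}{\|\ell(\omega,z)\|},\quad \mathfrak{Re}(\omega)=\frac{\langle \ell(\omega,z),Y(\omega,z)\rangle}{\|\ell(\omega,z)\|\|Y(\omega,z)\|},\quad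 \mathfrak{Im}(\omega)=\frac{\langle \dot\ell(\omega,z),Y(\omega,z)\rangle}{\|\dot\ell(\omega,z)\|\|Y(\omega,z)\|},$$ $\vartheta(\omega)=\arg(\mathfrak{Re}(\omega)+j\,\mathfrak{Im}(\omega))$ ($\omega$-phase), $r(\omega)=|\mathfrak{Re}(\omega)+j\,\mathfrak{Im}(\omega)|$ ($\omega$-radius). The frequency response function is $\Gamma(\omega)=\alpha(\omega)\,r(\omega)\,e^{j\vartheta(\omega)}$. It is understood that $\omega$ is such that these quantities are defined, i.e. $Y(\omega,z(\cdot))$ is not identically zero. *)

(* Defs.v *)
From mathcomp Require Import all_boot all_order all_algebra.
From mathcomp Require Import complex.
From mathcomp Require Import all_classical all_reals all_analysis.
Import Order.TTheory GRing.Theory Num.Theory.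
Import numFieldNormedType.Exports.

Set Implicit Arguments.
Unset Strict Implicit.
Unset Printing Implicit Defensive.

Local Open Scope classical_set_scope.
Local Open Scope ring_scope.
Local Open Scope complex_scope.

Definition cmx (R : realType) m n (M : 'M[R]_(m, n)) : 'M[R[i]]_(m, n) :=
  map_mx (real_complex R) M.

Definition hurwitz (R : realType) n (A : 'M[R]_n) : Prop :=
  forall lambda : R[i], eigenvalue (cmx A) lambda -> complex.Re lambda < 0.

(* Only meaningful when lambda is not an eigenvalue of A. *)
Definition transfer (R : realType) n
    (A : 'M[R]_n) (B : 'cV[R]_n) (C : 'rV[R]_n) (lambda : R[i]) : R[i] :=
  (cmx C *m invmx (lambda%:M - cmx A) *m cmx B) 0 0.

(* Two rational functions are equal iff they agree off their poles. *)
Definition same_transfer (R : realType) m n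
    (A : 'M[R]_m) (B : 'cV[R]_m) (C : 'rV[R]_m)
    (A' : 'M[R]_n) (B' : 'cV[R]_n) (C' : 'rV[R]_n) : Prop :=
  forall lambda : R[i],
    ~~ eigenvalue (cmx A) lambda -> ~~ eigenvalue (cmx A') lambda ->
    transfer A B C lambda = transfer A' B' C' lambda.

Definition minimal_realization (R : realType) n
    (A : 'M[R]_n) (B : 'cV[R]_n) (C : 'rV[R]_n) : Prop :=
  forall m (A' : 'M[R]_m) (B' : 'cV[R]_m) (C' : 'rV[R]_m),
    same_transfer A B C A' B' C' -> (n <= m)%N.

(* [[0, w], [-w, 0]] *)
Definition gen_S (R : realType) (w : R) : 'M[R]_2 :=
  \matrix_(i, j) (if (i == 0) && (j == 1) then w
                  else if (i == 1) && (j == 0) then - w else 0).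

(* [1, 0] *)
Definition gen_L (R : realType) : 'rV[R]_2 := \row_j (j == 0)%:R.

(* The parameter omega = (w, a, phi) : frequency, amplitude, phase. *)
Record signal_param (R : realType) :=
  SignalParam { freq : R; amp : R; phase : R }.

Definition positive_param (R : realType) (omega : signal_param R) : Prop :=
  0 < freq omega /\ 0 < amp omega.

Definition gen_z0 (R : realType) (omega : signal_param R) : 'cV[R]_2 :=
  \col_i (if i == 0 then amp omega * sin (phase omega)
          else amp omega * cos (phase omega)).

Definition gen_trajectory (R : realType) (omega : signal_param R)
    (z : R -> 'cV[R]_2) : Prop :=
  z 0 = gen_z0 omega /\
  forall t : R, is_derive t 1 z (gen_S (freq omega) *m z t).

(* The initial value problem has exactly one solution, so the default value
   of xget is never used. *)
Definition gen_z (R : realType) (omega : signal_param R) : R -> 'cV[R]_2 :=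
  xget (cst 0) [set z | gen_trajectory omega z].

Definition sylvester (R : realType) n (A : 'M[R]_n) (B : 'cV[R]_n) (w : R)
    (P : 'M[R]_(n, 2)) : Prop :=
  A *m P + B *m gen_L R = P *m gen_S w.

(* For A Hurwitz the spectra of A and gen_S w are disjoint, so the Sylvester
   equation has exactly one solution and the default value is never used. *)
Definition Phi (R : realType) n (A : 'M[R]_n) (B : 'cV[R]_n) (w : R) :
    'M[R]_(n, 2) :=
  xget 0 [set P | sylvester A B w P].

Definition input (R : realType) (omega : signal_param R) (t : R) : 'cV[R]_1 :=
  gen_L R *m gen_z omega t.

Definition dinput (R : realType) (omega : signal_param R) : R -> 'cV[R]_1 :=
  derive1 (input omega).

Definition response (R : realType) n
    (A : 'M[R]_n) (B : 'cV[R]_n) (C : 'rV[R]_n) (omega : signal_param R) (t : R) :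
    'cV[R]_1 :=
  C *m Phi A B (freq omega) *m gen_z omega t.

Definition period (R : realType) (omega : signal_param R) : R :=
  2 * pi / freq omega.

Definition inner (R : realType) p (T : R) (f g : R -> 'cV[R]_p) : R :=
  Rintegral lebesgue_measure `[0, T] (fun t => ((f t)^T *m g t) 0 0).

Definition L2norm (R : realType) p (T : R) (f : R -> 'cV[R]_p) : R :=
  Num.sqrt (inner T f f).

Definition gain (R : realType) n
    (A : 'M[R]_n) (B : 'cV[R]_n) (C : 'rV[R]_n) (omega : signal_param R) : R :=
  L2norm (period omega) (response A B C omega)
  / L2norm (period omega) (input omega).

Definition frRe (R : realType) n
    (A : 'M[R]_n) (B : 'cV[R]_n) (C : 'rV[R]_n) (omega : signal_param R) : R :=
  inner (period omega) (input omega) (response A B C omega)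
  / (L2norm (period omega) (input omega)
     * L2norm (period omega) (response A B C omega)).

Definition frIm (R : realType) n
    (A : 'M[R]_n) (B : 'cV[R]_n) (C : 'rV[R]_n) (omega : signal_param R) : R :=
  inner (period omega) (dinput omega) (response A B C omega)
  / (L2norm (period omega) (dinput omega)
     * L2norm (period omega) (response A B C omega)).

Definition cexpi (R : realType) (theta : R) : R[i] := cos theta +i* sin theta.

(* Principal argument, in ]-pi, pi]; at x = 0 any such angle satisfies the defining property. *)
Definition carg (R : realType) (x : R[i]) : R :=
  xget 0 [set theta | theta \in `]- pi, pi] /\
                      x = (ComplexField.Normc.normc x)%:C * cexpi theta].

Definition omega_phase (R : realType) n
    (A : 'M[R]_n) (B : 'cV[R]_n) (C : 'rV[R]_n) (omega : signal_param R) : R :=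
  carg (frRe A B C omega +i* frIm A B C omega).

Definition omega_radius (R : realType) n
    (A : 'M[R]_n) (B : 'cV[R]_n) (C : 'rV[R]_n) (omega : signal_param R) : R :=
  ComplexField.Normc.normc (frRe A B C omega +i* frIm A B C omega).

Definition Gamma (R : realType) n
    (A : 'M[R]_n) (B : 'cV[R]_n) (C : 'rV[R]_n) (omega : signal_param R) : R[i] :=
  (gain A B C omega)%:C * (omega_radius A B C omega)%:C
  * cexpi (omega_phase A B C omega).

(* Main.v *)
(** Along the trajectory z(t) = a (sin (phi + w t), cos (phi + w t)) of the signal
    generator, the input, its derivative and the response are all sinusoids of
    frequency w, and over one period the functions p sin + q cos and p' sin + q' cos
    have inner product (p p' + q q') pi / w.  Writing C Phi = (p, q), the gain is
    therefore sqrt (p^2 + q^2), the real and imaginary parts are p and q divided by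
    this gain, and Gamma = p + i q.  On the other hand the two columns of the
    Sylvester equation are the real and imaginary parts of
    (i w - A) (Phi_1 + i Phi_2) = B, so that H (i w) = p + i q. *)

Require Import Defs.
From mathcomp Require Import all_boot all_order all_algebra.
From mathcomp Require Import complex ring lra.
From mathcomp Require Import all_classical all_reals all_analysis.
Import Order.TTheory GRing.Theory Num.Theory.
Import numFieldNormedType.Exports.

Local Open Scope ring_scope.
Local Open Scope complex_scope.

(** * Complexified matrices and the Sylvester equation *)

Lemma forall_ord2 (P : 'I_2 -> Prop) : P 0 -> P 1 -> forall i, P i.
Proof.
move=> P0 P1 [[|[|//]] h].
  by rewrite (_ : Ordinal h = 0) //; exact/val_inj.
by rewrite (_ : Ordinal h = 1) //; exact/val_inj.
Qed.

Lemma sum_ord2 (V : nmodType) (F : 'I_2 -> V) : \sum_i F i = F 0 + F 1.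
Proof. by rewrite big_ord_recl big_ord1; congr (_ + F _); exact/val_inj. Qed.

Definition complex_mx {R : realType} {m n} (X Y : 'M[R]_(m, n)) : 'M[R[i]]_(m, n) :=
  \matrix_(i, j) (X i j +i* Y i j).

Lemma complex_mx_inj {R : realType} {m n} {X Y X' Y' : 'M[R]_(m, n)} :
  complex_mx X Y = complex_mx X' Y' -> X = X' /\ Y = Y'.
Proof.
by move=> /matrixP e; split; apply/matrixP => i j; move: (e i j); rewrite !mxE => -[].
Qed.

Lemma sum_complex (R : realType) (I : finType) (f g : I -> R) :
  \sum_i (f i +i* g i) = (\sum_i f i) +i* (\sum_i g i).
Proof. by elim/big_rec3: _ => // i x y z _ ->. Qed.

Lemma mul_cmx_complex_mx (R : realType) m n p (A : 'M[R]_(m, n)) (X Y : 'M[R]_(n, p)) :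
  cmx A *m complex_mx X Y = complex_mx (A *m X) (A *m Y).
Proof.
apply/matrixP => i j; rewrite !mxE -sum_complex; apply: eq_bigr => k _.
by rewrite !mxE; simpc.
Qed.

Lemma resolvent_complex_mx (R : realType) n (A : 'M[R]_n) (w : R) (x y : 'cV[R]_n) :
  ((0 +i* w)%:M - cmx A) *m complex_mx x y =
  complex_mx (- (w *: y) - A *m x) (w *: x - A *m y).
Proof.
rewrite mulmxBl mul_cmx_complex_mx mul_scalar_mx.
by apply/matrixP => i j; rewrite !mxE; simpc.
Qed.

Lemma mul_gen_S {R : realType} {n} (P : 'M[R]_(n, 2)) (w : R) i :
  (P *m gen_S w) i 0 = - (w * P i 1) /\ (P *m gen_S w) i 1 = w * P i 0.
Proof.
split; rewrite !mxE sum_ord2 !mxE /= ?mulr0.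
- by rewrite add0r mulrN mulrC.
- by rewrite addr0 mulrC.
Qed.

Lemma mul_gen_L {R : realType} {n} (B : 'cV[R]_n) i :
  (B *m gen_L R) i 0 = B i 0 /\ (B *m gen_L R) i 1 = 0.
Proof. by split; rewrite !mxE big_ord1 !mxE /= ?mulr1 ?mulr0. Qed.

(** Serves in both directions: right to left it builds a solution from the resolvent, left to right
    it evaluates the transfer function. *)
Lemma sylvester_resolvent (R : realType) n (A : 'M[R]_n) (B : 'cV[R]_n) (w : R)
    (P : 'M[R]_(n, 2)) :
  sylvester A B w P <->
  ((0 +i* w)%:M - cmx A) *m complex_mx (col 0 P) (col 1 P) = cmx B.
Proof.
have cmxE : cmx B = complex_mx B 0 by apply/matrixP => i j; rewrite !mxE.
rewrite resolvent_complex_mx cmxE /sylvester !colE !mulmxA -!colE.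
set Q := A *m P.
have reE i : (- (w *: col 1 P) - col 0 Q) i 0 = - (w * P i 1) - Q i 0 by rewrite !mxE.
have imE i : (w *: col 0 P - col 1 Q) i 0 = w * P i 0 - Q i 1 by rewrite [LHS]mxE !mxE.
have lE i j : (Q + B *m gen_L R) i j = Q i j + (B *m gen_L R) i j by rewrite [LHS]mxE.
split=> [e|/complex_mx_inj[e0 e1]].
  congr complex_mx; apply/colP => i.
    rewrite reE; move: (lE i 0).
    by rewrite e (mul_gen_S P w i).1 (mul_gen_L B i).1; lra.
  rewrite imE [RHS]mxE; move: (lE i 1).
  by rewrite e (mul_gen_S P w i).2 (mul_gen_L B i).2; lra.
apply/matrixP => i; apply: forall_ord2; rewrite lE.
  rewrite (mul_gen_S P w i).1 (mul_gen_L B i).1 -e0 reE; lra.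
have := imE i; rewrite e1 [LHS]mxE (mul_gen_S P w i).2 (mul_gen_L B i).2; lra.
Qed.

Lemma transfer_sylvester {R : realType} {n} {A : 'M[R]_n} {B : 'cV[R]_n} (C : 'rV[R]_n)
    {w : R} {P : 'M[R]_(n, 2)} :
  (0 +i* w)%:M - cmx A \in unitmx -> sylvester A B w P ->
  transfer A B C (0 +i* w) = (C *m P) 0 0 +i* (C *m P) 0 1.
Proof.
move=> uM /sylvester_resolvent eP.
rewrite /transfer -eP -mulmxA (mulKmx uM) mul_cmx_complex_mx mxE.
by rewrite !colE !mulmxA -!colE !mxE.
Qed.

(** The number [i w] has real part 0, so it is not an eigenvalue of a Hurwitz matrix. *)
Lemma hurwitz_resolvent_unit {R : realType} {n} {A : 'M[R]_n} (w : R) :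
  hurwitz A -> (0 +i* w)%:M - cmx A \in unitmx.
Proof.
move=> hA; have : ~~ eigenvalue (cmx A) (0 +i* w).
  by apply/negP => /hA /=; rewrite ltxx.
rewrite /eigenvalue /eigenspace negbK kermx_eq0 row_free_unit => u.
(* [eigenspace] is the kernel of [A - i w], the opposite of the matrix at hand. *)
by rewrite -opprB -scaleN1r unitmxZ // unitrN1.
Qed.

(** As soon as a solution exists, [xget] returns one. The witness has as columns the real and
    imaginary parts of [(i w - A)^-1 B]. *)
Lemma Phi_sylvester {R : realType} {n} {A : 'M[R]_n} (B : 'cV[R]_n) (w : R) :
  hurwitz A -> sylvester A B w (Phi A B w).
Proof.
move=> hA; apply: xgetPex.
have [v vE] : exists v, ((0 +i* w)%:M - cmx A) *m v = cmx B.
  exists (invmx ((0 +i* w)%:M - cmx A) *m cmx B).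
  by rewrite mulKVmx // hurwitz_resolvent_unit.
exists (\matrix_(i, j) if j == 0 then complex.Re (v i 0) else complex.Im (v i 0)).
apply/sylvester_resolvent; rewrite -[RHS]vE; congr (_ *m _).
by apply/colP => i; rewrite !mxE /=; case: (v i 0).
Qed.

(** * Polar form of a complex number *)

Lemma cargP (R : realType) (x : R[i]) :
  x = (ComplexField.Normc.normc x)%:C * cexpi (carg x).
Proof.
suff : exists th, th \in `]- pi, pi] /\ x = (ComplexField.Normc.normc x)%:C * cexpi th.
  by move=> /(xgetPex 0) -[].
have pi0 : 0 < pi :> R := pi_gt0 R.
have [/ComplexField.Normc.eq0_normc->|r0] := eqVneq (ComplexField.Normc.normc x) 0.
  exists 0; rewrite ComplexField.Normc.normc0 mul0r in_itv /=; split=> //.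
  by apply/andP; split; lra.
set r := ComplexField.Normc.normc x in r0 *.
have rge0 : 0 <= r by rewrite /r; case: (x) => a b; exact: sqrtr_ge0.
case: x @r r0 rge0 => a b r r0 rge0.
have rgt0 : 0 < r by rewrite lt_def r0.
have rE : r ^+ 2 = a ^+ 2 + b ^+ 2 by rewrite sqr_sqrtr // addr_ge0 ?sqr_ge0.
have ar : -1 <= a / r <= 1.
  rewrite ler_pdivlMr // ler_pdivrMr //; apply/andP; split; nra.
(* [acos] takes values in [[0, pi]], where the sine is nonnegative, so only [|b|] is recovered and
   the sign of [b] must select the angle. *)
have sinE : sin (acos (a / r)) = `|b| / r.
  rewrite sin_acos // -[LHS]/(Num.sqrt _) (_ : 1 - _ = (b / r) ^+ 2).
    by rewrite sqrtr_sqr normrM normfV (gtr0_norm rgt0).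
  rewrite !expr_div_n rE; field.
  by rewrite -rE sqrf_eq0.
have cosE : cos (acos (a / r)) = a / r by rewrite acosK // in_itv.
have [b0|b0] := leP 0 b.
  exists (acos (a / r)); split.
    rewrite in_itv /= acos_lepi // andbT.
    by apply: lt_le_trans (acos_ge0 ar); lra.
  rewrite /cexpi cosE sinE ger0_norm //; simpc.
  by rewrite !(mulrC r) !divfK.
(* Here [b < 0] gives [-1 < a / r] strictly, which keeps the angle off the excluded endpoint
   [- pi]. *)
exists (- acos (a / r)); split.
  rewrite in_itv /= ltrN2 acos_ltpi ?(le_trans (_ : _ <= 0) (ltW pi0)) //=.
    by rewrite oppr_le0 acos_ge0.
  by rewrite ltr_pdivlMr // ler_pdivrMr //; apply/andP; split; nra.
rewrite /cexpi cosN sinN cosE sinE ltr0_norm //; simpc.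
by rewrite !(mulrC r) !divfK.
Qed.

(** * Derivatives and integrals of sinusoids *)

Lemma is_derive_sin_affine {R : realType} (w phi t : R) :
  is_derive t 1 (fun s => sin (phi + w * s)) (w * cos (phi + w * t)).
Proof.
have h : is_derive t 1 (fun s => phi + w * s) w.
  by apply: is_derive_eq; rewrite ?scaler0 ?addr0 ?add0r /= ?mul1r; exact: mulr1.
by rewrite mulrC; exact: is_derive1_comp.
Qed.

Lemma is_derive_cos_affine {R : realType} (w phi t : R) :
  is_derive t 1 (fun s => cos (phi + w * s)) (- (w * sin (phi + w * t))).
Proof.
have h : is_derive t 1 (fun s => phi + w * s) w.
  by apply: is_derive_eq; rewrite ?scaler0 ?addr0 ?add0r /= ?mul1r; exact: mulr1.
by rewrite mulrC -mulNr; exact: is_derive1_comp.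
Qed.

Lemma is_derive_mxP {R : realType} {m n} {M : R -> 'M[R]_(m, n)} {t v : R}
    {D : 'M[R]_(m, n)} :
  is_derive t v M D <-> forall i j, is_derive t v (fun s => M s i j) (D i j).
Proof.
split=> [[dM <-] i j|dM].
  split; first exact: (derivable_mxP M t v).1.
  by rewrite derive_mx // mxE.
have dM' : derivable M t v.
  by apply/derivable_mxP => i j; have [] := dM i j.
split=> //; rewrite derive_mx //; apply/matrixP => i j; rewrite mxE.
exact: derive_val.
Qed.

Lemma continuous_of_is_derive {R : realType} {f df : R -> R} :
  (forall t : R, is_derive t 1 f (df t)) -> continuous f.
Proof.
move=> h t; apply/differentiable_continuous/derivable1_diffP.
by have [] := h t.
Qed.

Lemma Rintegral_is_derive {R : realType} {f F : R -> R} {a b : R} : a < b ->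
  continuous f -> (forall t : R, is_derive t 1 F (f t)) ->
  Rintegral lebesgue_measure `[a, b]%classic f = F b - F a.
Proof.
move=> ab cf dF; have cF := continuous_of_is_derive dF.
rewrite /Rintegral (continuous_FTC2 ab (F := F)) //.
- exact: continuous_subspaceT.
- split=> [x _||]; first by have [] := dF x.
  + exact/cvg_at_right_filter/cF.
  + exact/cvg_at_left_filter/cF.
- by move=> x _; rewrite derive1E; exact: derive_val.
Qed.

Lemma Rintegral_sinusoids {R : realType} {w} (phi p q p' q' : R) : 0 < w ->
  Rintegral lebesgue_measure `[0, 2 * pi / w]%classic
    (fun t => (p * sin (phi + w * t) + q * cos (phi + w * t))
              * (p' * sin (phi + w * t) + q' * cos (phi + w * t)))
  = (p * p' + q * q') * (pi / w).
Proof.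
move=> w0; have wN0 : w != 0 by rewrite gt_eqF.
pose S (t : R) := sin (phi + w * t); pose K (t : R) := cos (phi + w * t).
have dS (t : R) : is_derive t 1 S (w * K t) := is_derive_sin_affine w phi t.
have dK (t : R) : is_derive t 1 K (- (w * S t)) := is_derive_cos_affine w phi t.
have SK (t : R) : K t * K t = 1 - S t * S t.
  by rewrite -(cos2Dsin2 (phi + w * t)) !expr2 addrK.
(* The integrand is the mean value [al] plus multiples of [K^2 - S^2] and [S K], whose
   antiderivatives are [S K / w] and [S^2 / (2 w)]. *)
pose al := (p * p' + q * q') / 2; pose be := (q * q' - p * p') / (2 * w).
pose ga := (p * q' + q * p') / (2 * w).
have dF (t : R) : is_derive t 1 (fun t => al * t + be * (S t * K t) + ga * (S t * S t))
    ((p * S t + q * K t) * (p' * S t + q' * K t)).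
  apply: is_derive_eq; rewrite /GRing.scale /=.
  have -> : (p * S t + q * K t) * (p' * S t + q' * K t) =
      p * p' * (S t * S t) + q * q' * (K t * K t)
      + (p * q' + q * p') * (S t * K t) by ring.
  transitivity (al + be * w * (K t * K t - S t * S t)
      + ga * (2 * w) * (S t * K t)); first by ring.
  by rewrite SK /al /be /ga; field.
have cF : continuous (fun t : R => (p * S t + q * K t) * (p' * S t + q' * K t)).
  have cS := continuous_of_is_derive dS.
  have cK := continuous_of_is_derive dK.
  have cl u v : continuous (fun t => u * S t + v * K t).
    move=> t; apply: cvgD; apply: cvgM;
      [exact: cvg_cst|exact: cS|exact: cvg_cst|exact: cK].
  by move=> t; apply: cvgM; exact: cl.
have T0 : 0 < 2 * pi / w by rewrite divr_gt0 // mulr_gt0 // pi_gt0.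
rewrite (Rintegral_is_derive T0 cF dF).
(* A full turn: the periodic terms of the antiderivative cancel and only [al * t] contributes. *)
have T2 : phi + w * (2 * pi / w) = phi + pi *+ 2 by rewrite -mulr_natl; field.
by rewrite /S /K T2 sinD2pi cosD2pi !mulr0 !addr0 /al; field.
Qed.

(** * Trajectory of the signal generator *)

Lemma gen_trajectory_unique {R : realType} {omega : signal_param R} {z z'} :
  gen_trajectory omega z -> gen_trajectory omega z' -> z = z'.
Proof.
move=> [z0 dz] [z0' dz']; apply/funext => t.
pose d i (s : R) := z s i 0 - z' s i 0.
pose w := freq omega.
have SE (v : 'cV[R]_2) : (gen_S w *m v) 0 0 = w * v 1 0 /\
    (gen_S w *m v) 1 0 = - (w * v 0 0).
  split; rewrite !mxE sum_ord2 !mxE /=.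
  - by rewrite mul0r add0r.
  - by rewrite mul0r addr0 mulNr.
have dd0 (s : R) : is_derive s 1 (d 0) (w * d 1 s).
  have := is_derive_mxP.1 (dz s) 0 0.
  have := is_derive_mxP.1 (dz' s) 0 0.
  rewrite !(SE _).1 => h' h; rewrite mulrBr; exact: is_deriveB.
have dd1 (s : R) : is_derive s 1 (d 1) (- (w * d 0 s)).
  have := is_derive_mxP.1 (dz s) 1 0.
  have := is_derive_mxP.1 (dz' s) 1 0.
  rewrite !(SE _).2 => h' h; rewrite mulrBr opprD; exact: is_deriveB.
(* gen_S is skew-symmetric, so the squared distance of two solutions is constant. *)
have dE (s : R) : is_derive s 1 (fun s => d 0 s * d 0 s + d 1 s * d 1 s) 0.
  by apply: is_derive_eq; rewrite /GRing.scale /=; ring.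
(* Evaluated at time 0 the constant is 0, so both squares vanish at [t]. *)
have := is_derive_0_is_cst t 0 dE.
rewrite /= /d z0 z0' !subrr mulr0 addr0 -!expr2 => /eqP.
rewrite paddr_eq0 ?sqr_ge0 // !sqrf_eq0 !subr_eq0 => /andP[/eqP e0 /eqP e1].
by apply/colP; exact: forall_ord2.
Qed.

(** The explicit rotation solves the initial value problem; uniqueness identifies it with the
    solution picked by [xget]. *)
Lemma gen_zE (R : realType) (omega : signal_param R) :
  gen_z omega = fun t => \col_i
    (if i == 0 then amp omega * sin (phase omega + freq omega * t)
     else amp omega * cos (phase omega + freq omega * t)).
Proof.
set z := RHS; have zP : gen_trajectory omega z.
  split; first by apply/colP => i; rewrite !mxE mulr0 addr0.
  move=> t; apply/is_derive_mxP => i j; rewrite (ord1 j) {j}.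
  have dS := is_derive_sin_affine (freq omega) (phase omega) t.
  have dK := is_derive_cos_affine (freq omega) (phase omega) t.
  move: i; apply: forall_ord2.
    rewrite (_ : (fun s => z s 0 0) =
        fun s => amp omega * sin (phase omega + freq omega * s)); last first.
      by apply/funext => s; rewrite /z mxE.
    apply: is_derive_eq; rewrite !mxE sum_ord2 !mxE /= /GRing.scale /=; ring.
  rewrite (_ : (fun s => z s 1 0) =
        fun s => amp omega * cos (phase omega + freq omega * s)); last first.
    by apply/funext => s; rewrite /z mxE.
  apply: is_derive_eq; rewrite !mxE sum_ord2 !mxE /= /GRing.scale /=; ring.
apply: gen_trajectory_unique (zP); exact: xgetPex _ (ex_intro _ _ zP).
Qed.

(** * Sinusoidal signals and the frequency response *)

(** A common shape for the input, its derivative and the response, so that inner products depend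
    only on coefficient pairs. *)
Definition sinusoid {R : realType} (omega : signal_param R) (p q t : R) : 'cV[R]_1 :=
  \col__ (p * sin (phase omega + freq omega * t)
          + q * cos (phase omega + freq omega * t)).

Lemma inner_sinusoid (R : realType) (omega : signal_param R) (p q p' q' : R) :
  positive_param omega ->
  inner (period omega) (sinusoid omega p q) (sinusoid omega p' q') =
  (p * p' + q * q') * (pi / freq omega).
Proof.
move=> [w0 _]; rewrite -(Rintegral_sinusoids (phase omega)) //.
by congr Rintegral; apply/funext => t; rewrite !mxE big_ord1 !mxE.
Qed.

Lemma L2norm_sinusoid (R : realType) (omega : signal_param R) (p q : R) :
  positive_param omega ->
  L2norm (period omega) (sinusoid omega p q) =
  Num.sqrt (p ^+ 2 + q ^+ 2) * Num.sqrt (pi / freq omega).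
Proof.
move=> h; rewrite /L2norm inner_sinusoid // -!expr2 sqrtrM //.
by rewrite addr_ge0 ?sqr_ge0.
Qed.

Lemma inputE (R : realType) (omega : signal_param R) :
  input omega = sinusoid omega (amp omega) 0.
Proof.
apply/funext => t; apply/colP => i; rewrite /input gen_zE !mxE sum_ord2 !mxE /=.
ring.
Qed.

Lemma dinputE (R : realType) (omega : signal_param R) :
  dinput omega = sinusoid omega 0 (amp omega * freq omega).
Proof.
apply/funext => t; rewrite /dinput inputE derive1E.
have h : is_derive t 1 (sinusoid omega (amp omega) 0)
    (sinusoid omega 0 (amp omega * freq omega) t).
  apply/is_derive_mxP => i j; rewrite mxE.
  rewrite (_ : (fun s => _) =
      fun s => amp omega * sin (phase omega + freq omega * s)); last first.
    by apply/funext => s; rewrite mxE mul0r addr0.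
  have dS := is_derive_sin_affine (freq omega) (phase omega) t.
  by apply: is_derive_eq; rewrite /GRing.scale /=; ring.
exact: derive_val.
Qed.

Lemma responseE (R : realType) n (A : 'M[R]_n) (B : 'cV[R]_n) (C : 'rV[R]_n)
    (omega : signal_param R) (H := C *m Phi A B (freq omega)) :
  response A B C omega = sinusoid omega (amp omega * H 0 0) (amp omega * H 0 1).
Proof.
(* Forgetting the body of [H] keeps [mxE] from expanding the product. *)
apply/funext => t; rewrite /response gen_zE -/H; move: H => H.
apply/colP => i; rewrite (ord1 i) mxE sum_ord2 !mxE /=; ring.
Qed.

Theorem proposition4 (R : realType) (n : nat)
    (A : 'M[R]_n) (B : 'cV[R]_n) (C : 'rV[R]_n)
    (hmin : minimal_realization A B C) (hA : hurwitz A)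
    (omega : signal_param R) (homega : positive_param omega)
    (hY : exists t : R, response A B C omega t <> 0) :
  Gamma A B C omega = transfer A B C (0 +i* freq omega).
Proof.
rewrite (transfer_sylvester _ (hurwitz_resolvent_unit _ hA)
  (Phi_sylvester _ _ hA)).
(* Gamma sees the radius and the phase only through r e^(j theta) = Re + j Im. *)
rewrite /Gamma -mulrA /omega_phase /omega_radius -cargP /gain /frRe /frIm.
move: hY; rewrite inputE dinputE responseE !L2norm_sinusoid // !inner_sinusoid //.
set p := (C *m _) 0 0; set q := (C *m _) 0 1 => hY.
have [w0 a0] := homega; move: (freq omega) (amp omega) w0 a0 hY => w a w0 a0 hY.
(* [k] is a factor of every norm and [k^2] of every inner product, so it cancels from all
   quotients. *)
set k := Num.sqrt (pi / w).
have kE : pi / w = k ^+ 2 by rewrite sqr_sqrtr // divr_ge0 ?pi_ge0 // ltW.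
have k0 : k != 0 by rewrite gt_eqF // sqrtr_gt0 divr_gt0 ?pi_gt0.
set m := Num.sqrt (p ^+ 2 + q ^+ 2).
(* If [m = 0] then [p = q = 0] and the response vanishes identically, against [hY]. *)
have m0 : m != 0.
  apply/eqP => /eqP; rewrite sqrtr_eq0 => m0; case: hY => t; apply.
  have : p ^+ 2 + q ^+ 2 == 0 by rewrite eq_le m0 addr_ge0 ?sqr_ge0.
  rewrite paddr_eq0 ?sqr_ge0 // !sqrf_eq0 => /andP[/eqP-> /eqP->].
  by apply/colP => i; rewrite !mxE !mulr0 !mul0r addr0.
have -> : Num.sqrt ((a * p) ^+ 2 + (a * q) ^+ 2) = a * m.
  by rewrite !exprMn -mulrDr sqrtrM ?sqr_ge0 // sqrtr_sqr gtr0_norm.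
have -> : Num.sqrt (a ^+ 2 + 0 ^+ 2) = a by rewrite expr0n addr0 sqrtr_sqr gtr0_norm.
have -> : Num.sqrt (0 ^+ 2 + (a * w) ^+ 2) = a * w.
  by rewrite expr0n add0r sqrtr_sqr gtr0_norm // mulr_gt0.
rewrite kE; have aN0 : a != 0 by rewrite gt_eqF.
have wN0 : w != 0 by rewrite gt_eqF.
(* The gain is [m], and the real and imaginary parts are [p / m] and [q / m]. *)
by simpc; congr (_ +i* _); field; rewrite ?k0 ?m0 ?aN0 ?wN0.
Qed.
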